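(* For every real $\epsilon>0$ there exists $N_0=N_0(\epsilon)$ such that the following holds. Let $G$ be a properly edge-coloured bipartite multigraph with $n\geq N_0$ colours and at least $(1+\epsilon)n$ edges of each colour. Then $G$ contains a rainbow matching using every colour.
   Context: Multigraphs are finite; parallel edges are allowed. An edge-colouring is proper if any two distinct edges sharing a vertex (in particular any two parallel edges) have different colours. A matching is a set of pairwise vertex-disjoint edges; it is rainbow if its edges have pairwise different colours. A rainbow matching uses every colour if each of the $n$ colours appears on one of its edges (so it has size $n$). *)

(* Defs.v *)
From HB Require Import structures.
From mathcomp Require Import all_boot all_order all_algebra.
From mathcomp Require Import reals.

Set Implicit Arguments.
Unset Strict Implicit.
Unset Printing Implicit Defensive.

(* Edges form a type of their own, so distinct edges may have the same pair of
   ends (parallel edges). Loops are excluded. *)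
Record multigraph := Multigraph {
  vertex : finType;
  edge : finType;
  ends : edge -> {set vertex};
  card_ends : forall e : edge, #|ends e| = 2
}.

Definition share_vertex (G : multigraph) (e f : edge G) : bool :=
  [exists v, (v \in ends e) && (v \in ends f)].

Definition bipartite (G : multigraph) : Prop :=
  exists A : {set vertex G},
    forall e : edge G,
      exists x y : vertex G, [/\ x \in A, y \notin A & ends e = [set x; y]].

Section Colouring.
Variables (G : multigraph) (n : nat) (col : edge G -> 'I_n).

Definition proper_colouring : Prop :=
  forall e f : edge G, e != f -> share_vertex e f -> col e != col f.

Definition colour_class (i : 'I_n) : {set edge G} := [set e | col e == i].

Definition matching (M : {set edge G}) : Prop :=
  {in M &, forall e f : edge G, e != f -> ~~ share_vertex e f}.

Definition rainbow (M : {set edge G}) : Prop :=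
  {in M &, forall e f : edge G, e != f -> col e != col f}.

Definition uses_every_colour (M : {set edge G}) : Prop :=
  forall i : 'I_n, exists2 e : edge G, e \in M & col e = i.

End Colouring.

(* Main.v *)
Require Import Defs.
From HB Require Import structures.
From mathcomp Require Import all_boot all_order all_algebra.
From mathcomp Require Import reals.
From mathcomp Require Import zify.
Import Order.TTheory GRing.Theory Num.Theory.
Local Open Scope ring_scope.

Set Implicit Arguments.
Unset Strict Implicit.

(** A counting argument splits off a small set of vertices on each side such that
    the edges between the two small sets (the reserve) still contain a positive
    proportion of every colour, while at least [n] edges of each colour avoid both
    small sets. An alternating path argument of Woolbright, applied to the latter
    edges, gives a rainbow matching missing at most [sqrt n] colours; the missing
    colours are then added greedily from the reserve. *)

(** * Random vertex subsets by counting *)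

Section Sampling.
Local Open Scope nat_scope.

(** Distributivity turns the sum over all functions into a product over the points of [T]; a point
    outside [S] contributes the factor [k]. *)
Lemma sum_prod_weights (T : finType) (k : nat) (w : 'I_k -> nat) (S : {set T}) :
  \sum_(f : {ffun T -> 'I_k}) \prod_(x in S) w (f x) =
  (\sum_i w i) ^ #|S| * k ^ (#|T| - #|S|).
Proof.
transitivity (\prod_x \sum_i (if x \in S then w i else 1)).
  by rewrite bigA_distr_bigA; apply: eq_bigr => f _; rewrite [LHS]big_mkcond.
rewrite (bigID (mem S)) /=; congr (_ * _).
  rewrite -prod_nat_const; apply: eq_bigr => x xS.
  by apply: eq_bigr => i _; rewrite xS.
have -> : #|T| - #|S| = #|[pred x | x \notin S]|.
  by rewrite -(cardC S) addKn.
rewrite -prod_nat_const; apply: eq_bigr => x /negPf xS.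
under eq_bigr => i _ do rewrite xS.
by rewrite sum1_card card_ord.
Qed.

(** Randomness is replaced by counting: for a uniformly chosen [f], a probability is a number of
    functions divided by [k.+1 ^ #|T|]. *)
Definition zeros (T : finType) (k : nat) (f : {ffun T -> 'I_k.+1}) : {set T} :=
  [set x | f x == ord0].

(* Markov's inequality for the moment [u ^ |S :&: Y| * v ^ |S :\: Y|] of a random set [Y]
   that contains each point independently with probability [1 / k.+1]. *)
Lemma markov_zeros (T : finType) (k u v t : nat) (S : {set T})
    (bad : pred {ffun T -> 'I_k.+1}) :
  (forall f, bad f -> t <= u ^ #|S :&: zeros f| * v ^ #|S :\: zeros f|) ->
  #|bad| * t <= (u + k * v) ^ #|S| * k.+1 ^ (#|T| - #|S|).
Proof.
move=> le_t; pose w (i : 'I_k.+1) := if i == ord0 then u else v.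
have <- : \sum_i w i = u + k * v.
  by rewrite big_ord_recl sum_nat_const card_ord.
rewrite -sum_prod_weights -sum_nat_const.
rewrite [X in _ <= X](bigID bad) /=; apply: leq_trans (leq_addr _ _).
apply: leq_sum => f /le_t /leq_trans; apply.
rewrite (bigID (mem (zeros f))) /= leq_mul //.
  rewrite -prod_nat_const (eq_bigl (fun x => (x \in S) && (x \in zeros f))).
    by apply/eq_leq/eq_bigr=> x; rewrite !inE /w => /andP[_ ->].
  by move=> x; rewrite inE.
rewrite -prod_nat_const (eq_bigl (fun x => (x \in S) && (x \notin zeros f))).
  by apply/eq_leq/eq_bigr=> x; rewrite !inE /w => /andP[_ /negPf->].
by move=> x; rewrite !inE andbC.
Qed.

Lemma leq_expl (m n e : nat) : m <= n -> m ^ e <= n ^ e.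
Proof. by case: e => // e; rewrite leq_exp2r. Qed.

Lemma bernoulli (m k : nat) : m ^ k * (m + k) <= m * m.+1 ^ k.
Proof.
elim: k => [|k IH]; first by rewrite !expn0; lia.
rewrite !expnS; move: IH; set x := m ^ k; set y := m.+1 ^ k => IH.
have : x * (m + k) * m.+1 <= m * y * m.+1 by rewrite leq_mul2r IH orbT.
nia.
Qed.

(** By Bernoulli, (1 + 1/m)^(m+1) is at least 1 + (m+1)/m, hence at least 2. *)
Lemma expn_pred_half (m : nat) : 0 < m -> 2 * m ^ m.+1 <= m.+1 ^ m.+1.
Proof.
move=> m_gt0; rewrite -(leq_pmul2l m_gt0); apply: leq_trans (bernoulli m m.+1).
by rewrite mulnA mulnC leq_mul2l; apply/orP; right; lia.
Qed.

(** Moment with [u = k.+1 = 4 ^ q] and [v = 1]: it is at least [4 ^ #|S|] on the bad event, while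
    its mean is at most [2 ^ #|S|]. *)
Lemma upper_tail (T : finType) (q k : nat) (S : {set T}) :
  k.+1 = 4 ^ q ->
  #|[pred f : {ffun T -> 'I_k.+1} | #|S| < q * #|S :&: zeros f|]| * 2 ^ #|S|
    <= k.+1 ^ #|T|.
Proof.
move=> k4; set B := #|[pred f | _ < _]|.
have le_B : B * 4 ^ #|S| <= (k.+1 + k * 1) ^ #|S| * k.+1 ^ (#|T| - #|S|).
  apply: markov_zeros => f /= /ltnW; rewrite exp1n muln1 k4 -expnM => le_S.
  by rewrite leq_pexp2l.
have S_T : #|S| <= #|T| by apply: max_card.
rewrite -(@leq_pmul2r (2 ^ #|S|)) ?expn_gt0 // -mulnA -expnMn.
apply: leq_trans le_B _.
apply: (@leq_trans ((2 * k.+1) ^ #|S| * k.+1 ^ (#|T| - #|S|))).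
  by rewrite leq_mul2r leq_expl ?orbT //; lia.
by rewrite expnMn -mulnA -expnD subnKC // mulnC.
Qed.

(** Moment with [u = 1] and [v = 2]. Write s for [#|S|] and j for the exponent in the statement. On
    the bad event the moment is at least 2^(s-j). Its mean is 2^s (1 - 1/(2k+2))^s, at most 2^s /
    4^j because (1 - 1/(2k+2))^(4k+4) is at most 1/4. The quotient is 2^(-j). *)
Lemma lower_tail (T : finType) (k : nat) (S : {set T}) :
  #|[pred f : {ffun T -> 'I_k.+1} | 4 * k.+1 * #|S :&: zeros f| < #|S|]|
    * 2 ^ (#|S| %/ (4 * k.+1)) <= k.+1 ^ #|T|.
Proof.
set B := #|[pred f | _ < _]|; set L := 4 * k.+1; set s := #|S|; set j := s %/ L.
have L_gt0 : 0 < L by [].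
have jL : j * L <= s := leq_trunc_div s L.
have js : j <= s by apply: leq_div.
have s_T : s <= #|T| by apply: max_card.
have le_B : B * 2 ^ (s - j) <= (1 + k * 2) ^ s * k.+1 ^ (#|T| - s).
  apply: markov_zeros => f /= lt_s; rewrite exp1n mul1n leq_pexp2l //.
  rewrite cardsD leq_sub2l // leq_divRL // mulnC; exact: ltnW.
have half : 4 * (1 + k * 2) ^ L <= (2 * k.+1) ^ L.
  have := @expn_pred_half (1 + k * 2) isT.
  rewrite -(leq_exp2r _ _ (isT : 0 < 2)) expnMn -!expnM.
  have -> : (1 + k * 2).+1 * 2 = L by rewrite /L; lia.
  by have -> : (1 + k * 2).+1 = 2 * k.+1 by lia.
clearbody B j L s.
have pow : 4 ^ j * (1 + k * 2) ^ s <= (2 * k.+1) ^ s.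
  rewrite -(subnKC jL) (mulnC j L) !expnD !expnM mulnA -expnMn leq_mul //.
    exact: leq_expl.
  by apply: leq_expl; lia.
rewrite -(@leq_pmul2r (2 ^ s)) ?expn_gt0 //.
have -> : B * 2 ^ j * 2 ^ s = B * 2 ^ (s - j) * 4 ^ j.
  have -> : 4 ^ j = 2 ^ j * 2 ^ j by rewrite -expnMn.
  by rewrite -{1}(subnK js) expnD; lia.
apply: leq_trans (leq_mul le_B (leqnn _)) _.
rewrite mulnAC (mulnC _ (4 ^ j)).
apply: leq_trans (leq_mul pow (leqnn _)) _.
by rewrite expnMn -mulnA -expnD subnKC // mulnC.
Qed.

Lemma union_bound (F I : finType) (P : I -> pred F) :
  (forall x, exists i, P i x) -> #|F| <= \sum_i #|P i|.
Proof.
move=> coverP; rewrite -sum1_card.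
under [X in _ <= X]eq_bigr => i _ do rewrite -sum1_card big_mkcond.
rewrite exchange_big leq_sum //= => x _; have [i Pi] := coverP x.
by rewrite (bigD1 i) //= unfold_in Pi.
Qed.

(** Union bound: there are [2 * #|I|] tail events at density [1 / 4 ^ q], each of probability at
    most [1 / 2 ^ (m %/ (4 * 4 ^ q))], so some sample avoids them all. *)
Lemma sample_subset (T I : finType) (S : I -> {set T}) (q m : nat) :
  (forall i, m <= #|S i|) -> 2 * #|I| < 2 ^ (m %/ (4 * 4 ^ q)) ->
  exists Y : {set T}, forall i,
    q * #|S i :&: Y| <= #|S i| /\ #|S i| <= 4 * 4 ^ q * #|S i :&: Y|.
Proof.
have [k k4] : exists k, k.+1 = 4 ^ q.
  by exists (4 ^ q).-1; rewrite prednK ?expn_gt0.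
rewrite -k4; set L := 4 * k.+1 => m_S ltI.
pose U i := [pred f : {ffun T -> 'I_k.+1} | #|S i| < q * #|S i :&: zeros f|].
pose D i := [pred f : {ffun T -> 'I_k.+1} | L * #|S i :&: zeros f| < #|S i|].
have small i : #|[predU U i & D i]| * 2 ^ (m %/ L) <= 2 * k.+1 ^ #|T|.
  apply: (@leq_trans ((#|U i| + #|D i|) * 2 ^ (m %/ L))).
    by rewrite leq_mul2r -cardUI leq_addr orbT.
  rewrite mulnDl mul2n -addnn leq_add //.
    apply: leq_trans (upper_tail (S i) k4); rewrite leq_mul2l.
    rewrite leq_pexp2l ?orbT //; apply: leq_trans (m_S i); exact: leq_div.
  apply: leq_trans (lower_tail k (S i)).
  by rewrite leq_mul2l leq_pexp2l ?orbT // leq_div2r.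
have [/existsP[f goodf]|] := boolP [exists f, [forall i, ~~ [predU U i & D i] f]].
  exists (zeros f) => i.
  by have /forallP/(_ i) := goodf; rewrite /= negb_or -!leqNgt => /andP[].
rewrite negb_exists => /forallP bad.
have /union_bound : forall f, exists i, [predU U i & D i] f.
  by move=> f; have := bad f; rewrite negb_forall => /existsP[i /negPn]; exists i.
rewrite card_ffun card_ord leqNgt => /negP[].
rewrite -(@ltn_pmul2r (2 ^ (m %/ L))) ?expn_gt0 // big_distrl /=.
apply: (@leq_ltn_trans (\sum_(i : I) 2 * k.+1 ^ #|T|)).
  by apply: leq_sum => i _; exact: small.
by rewrite sum_nat_const mulnA [X in _ < X]mulnC ltn_pmul2r ?expn_gt0 // mulnC.
Qed.

(** Transfers sampling from vertices to edges. For a colour class, [p] is an end map, injective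
    because the colouring is proper. *)
Lemma sample_preimage (E T I : finType) (p : E -> T) (D : I -> {set E}) (q m : nat) :
  (forall i, {in D i &, injective p}) ->
  (forall i, m <= #|D i|) -> 2 * #|I| < 2 ^ (m %/ (4 * 4 ^ q)) ->
  exists Y : {set T}, forall i,
    q * #|[set e in D i | p e \in Y]| <= #|D i| /\
    #|D i| <= 4 * 4 ^ q * #|[set e in D i | p e \in Y]|.
Proof.
move=> injp m_D ltI; have cardS i : #|p @: D i| = #|D i|.
  exact: card_in_imset.
have [|Y Yp] := sample_subset (S := fun i => p @: D i) _ ltI.
  by move=> i; rewrite cardS.
exists Y => i; have := Yp i; rewrite cardS.
have -> // : p @: D i :&: Y = p @: [set e in D i | p e \in Y].
  apply/setP=> x; rewrite inE; apply/andP/imsetP.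
    by move=> [/imsetP[e eD ->] eY]; exists e; rewrite // inE eD.
  by move=> [e]; rewrite inE => /andP[eD eY] ->; rewrite imset_f.
rewrite card_in_imset // => e f; rewrite !inE => /andP[eD _] /andP[fD _].
exact: injp eD fD.
Qed.

Lemma linear_lt_exp (L : nat) : 0 < L ->
  exists N, forall n, N <= n -> 4 * n < 2 ^ (n %/ L).
Proof.
(* The threshold makes [h] at least [8 * L], so the square of [h.+1], a lower bound for [2 ^ j],
   exceeds [8 * L * h.+1], which bounds [4 * n]. *)
move=> L_gt0; exists (16 * L * L) => n le_n.
set j := n %/ L; set h := j %/ 2.
have jL : n < j.+1 * L by apply: ltn_ceil.
have le_j : 16 * L <= j by rewrite /j leq_divRL.
have le_h : 8 * L <= h by rewrite /h leq_divRL //; lia.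
have j2 : h * 2 <= j := leq_trunc_div j 2.
have j2' : j < h.+1 * 2 by apply: ltn_ceil.
apply: (@leq_trans (2 ^ h * 2 ^ h)); last by rewrite -expnD leq_pexp2l //; lia.
apply: (@leq_trans (h.+1 * h.+1)); last by rewrite leq_mul // ltn_expl.
nia.
Qed.

End Sampling.

(** * Rainbow matchings given by two end maps *)

Section RainbowMatching.
Local Open Scope nat_scope.

Lemma card_preimset_in (E T : finType) (p : E -> T) (D : {set E}) (Y : {set T}) :
  {in D &, injective p} -> #|[set e in D | p e \in Y]| <= #|Y|.
Proof.
move=> injp; rewrite -(@card_in_imset _ _ p); last first.
  by move=> e f; rewrite !inE => /andP[eD _] /andP[fD _]; exact: injp.
by apply/subset_leq_card/subsetP=> _ /imsetP[e + ->]; rewrite inE => /andP[].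
Qed.

Lemma disjoint_imset (E T : finType) (p : E -> T) (Y : {set T}) (M N : {set E}) :
  (forall e, e \in M -> p e \notin Y) -> (forall e, e \in N -> p e \in Y) ->
  [disjoint p @: M & p @: N].
Proof.
move=> MY NY; rewrite -setI_eq0; apply/eqP/setP=> x; rewrite !inE.
apply/negP=> /andP[/imsetP[e eM ->] /imsetP[e' e'N eq_p]].
by have := MY e eM; rewrite eq_p NY.
Qed.

Variables (E V W C : finType) (a : E -> V) (b : E -> W) (col : E -> C).

(* [a e] and [b e] are the ends of [e] on the two sides; a bipartite matching is a
   set of edges on which both maps are injective. *)
Definition rainbow_matching (M : {set E}) : bool :=
  [&& dinjectiveb a M, dinjectiveb b M & dinjectiveb col M].

Lemma rainbow_matchingP (M : {set E}) :
  reflect [/\ {in M &, injective a}, {in M &, injective b} & {in M &, injective col}]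
          (rainbow_matching M).
Proof.
by apply: (iffP and3P) => -[/dinjectiveP ? /dinjectiveP ? /dinjectiveP ?].
Qed.

Lemma rainbow_matching0 : rainbow_matching set0.
Proof. by apply/rainbow_matchingP; split=> e f; rewrite inE. Qed.

Lemma rainbow_matchingS (M N : {set E}) :
  M \subset N -> rainbow_matching N -> rainbow_matching M.
Proof.
move=> /subsetP sMN /rainbow_matchingP [aN bN cN].
by apply/rainbow_matchingP; split; apply: (sub_in2 sMN).
Qed.

Lemma injectiveU (T : finType) (f : E -> T) (M N : {set E}) :
  {in M &, injective f} -> {in N &, injective f} ->
  [disjoint f @: M & f @: N] -> {in M :|: N &, injective f}.
Proof.
move=> injM injN dMN e e'; rewrite !inE => /orP[eM|eN] /orP[e'M|e'N] eq_f.
- exact: injM.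
- by have /negP[] := disjointFr dMN (imset_f f eM); rewrite eq_f imset_f.
- by have /negP[] := disjointFr dMN (imset_f f e'M); rewrite -eq_f imset_f.
- exact: injN.
Qed.

Lemma rainbow_matchingU (M N : {set E}) :
  rainbow_matching M -> rainbow_matching N ->
  [disjoint a @: M & a @: N] -> [disjoint b @: M & b @: N] ->
  [disjoint col @: M & col @: N] -> rainbow_matching (M :|: N).
Proof.
move=> /rainbow_matchingP [aM bM cM] /rainbow_matchingP [aN bN cN] da db dc.
by apply/rainbow_matchingP; split; apply: injectiveU.
Qed.

Lemma rainbow_matchingU1 (M : {set E}) (e : E) :
  rainbow_matching M -> a e \notin a @: M -> b e \notin b @: M ->
  col e \notin col @: M -> rainbow_matching (e |: M).
Proof.
move=> rM ae be ce; apply: rainbow_matchingU; rewrite ?imset_set1 ?disjoints1 //.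
by apply/rainbow_matchingP; split=> x y; rewrite !inE => /eqP-> /eqP->.
Qed.

Lemma card_rainbow_matching (M : {set E}) :
  rainbow_matching M -> #|col @: M| = #|M|.
Proof. by move=> /rainbow_matchingP [_ _ cM]; exact: card_in_imset. Qed.

Lemma notin_imsetD1 (T : finType) (f : E -> T) (M : {set E}) (e : E) :
  {in M &, injective f} -> e \in M -> f e \notin f @: (M :\ e).
Proof.
move=> injM eM; apply/imsetP=> -[x]; rewrite !inE => /andP[xe xM] /injM fx.
by rewrite fx // eqxx in xe.
Qed.

Hypothesis a_proper : forall e f, col e = col f -> a e = a f -> e = f.
Hypothesis b_proper : forall e f, col e = col f -> b e = b f -> e = f.

Lemma class_injective (T : Type) (p : E -> T) (c : C) (D : {set E}) :
  (forall e f, col e = col f -> p e = p f -> e = f) ->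
  {in [set e in D | col e == c] &, injective p}.
Proof.
move=> p_proper e f; rewrite !inE => /andP[_ /eqP ec] /andP[_ /eqP fc].
by apply: p_proper; rewrite ec.
Qed.

(** * Alternating paths from a maximum rainbow matching *)

Section Woolbright.
Variables (D M : {set E}).
Hypothesis class_large : forall c, #|C| <= #|[set e in D | col e == c]|.
Hypothesis sMD : M \subset D.
Hypothesis rM : rainbow_matching M.
Hypothesis maxM :
  forall N : {set E}, N \subset D -> rainbow_matching N -> #|N| <= #|M|.

(* [M'] is [M] modified along an alternating path that starts outside [M] and ends
   at [v], all of whose new edges have colours in [cs]. *)
Definition frees (cs : seq C) (v : V) (M' : {set E}) : Prop :=
  [/\ [/\ M' \subset D, rainbow_matching M' & #|M'| = #|M|],
      b @: M' = b @: M, {subset col @: M' <= [predU col @: M & cs]}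
    & v \notin a @: M'].

(** One more step of the alternating path: exchanging [e] for [t] keeps the [b]-ends, uses the new
    colour [c], and trades the freed vertex [a t] for [a e]. *)
Lemma frees_step (cs : seq C) (c : C) (v : V) (M' : {set E}) (e t : E) :
  c \notin cs -> c \notin col @: M -> frees cs (a t) M' ->
  t \in D -> col t = c -> e \in M' -> b e = b t -> a e != a t ->
  frees (c :: cs) (a e) (t |: (M' :\ e)).
Proof.
move=> c_cs c_M [[sD rM' cardM'] bM' colM' at_M'] tD tc eM' bet aet.
have [aI bI cI] := rainbow_matchingP _ rM'.
have sM'e : M' :\ e \subset M' by exact: subsetDl.
have cM' : c \notin col @: M'.
  by apply/negP=> /colM'; rewrite inE /= (negPf c_cs) (negPf c_M).
split; first split.
- by rewrite subUset sub1set tD (subset_trans sM'e).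
- apply: rainbow_matchingU1; first exact: rainbow_matchingS rM'.
  + by apply: contra at_M'; apply/subsetP/imsetS.
  + by rewrite -bet notin_imsetD1.
  + by rewrite tc; apply: contra cM'; apply/subsetP/imsetS.
- rewrite cardsU1 -cardM' (cardsD1 e M') eM' !inE.
  suff /negPf-> : t \notin M' by rewrite andbF.
  by apply: contra at_M'; apply: imset_f.
- by rewrite -bM' imsetU1 -bet -imsetU1 setD1K.
- move=> x; rewrite imsetU1 2!inE tc => /orP[/eqP->|].
    by rewrite !inE eqxx orbT.
  move=> /(subsetP (imsetS col sM'e)) /colM'.
  by rewrite !inE => /orP[->|->] //; rewrite !orbT.
- by rewrite imsetU1 inE negb_or inE aet notin_imsetD1.
Qed.

(* The vertices outside [N] can be freed; each new missing colour enlarges this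
   set by the number of missing colours, since an edge of that colour at a
   freed vertex must end in [b @: M], by maximality. *)
Lemma freed_vertices (cs : seq C) :
  uniq cs -> {in cs, forall c, c \notin col @: M} ->
  exists N : {set V},
    [/\ N \subset a @: M, #|N| + (#|C| - #|M|) * size cs <= #|M| &
        forall v, v \notin N -> exists2 M' : {set E}, frees cs v M' &
          {in M, forall e, e \notin M' -> a e \notin N}].
Proof.
have [aI bI cI] := rainbow_matchingP _ rM.
elim: cs => [_ _|c cs IH /= /andP[c_cs cs_uniq] csM].
  exists (a @: M); split=> //; first by rewrite muln0 addn0 leq_imset_card.
  move=> v vM; exists M; last by move=> e ->.
  by split=> // x; rewrite inE /= => ->.
have c_M : c \notin col @: M by apply: csM; rewrite inE eqxx.
have [|N [sNM cardN freeN]] := IH cs_uniq.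
  by move=> x xcs; apply: csM; rewrite inE xcs orbT.
pose Dc := [set e in D | col e == c].
pose T := [set e in Dc | a e \notin N].
have bT_M : b @: T \subset b @: M.
  apply/subsetP=> _ /imsetP[t + ->]; rewrite !inE => /andP[/andP[tD /eqP tc] atN].
  have [M' [[sM'D rM' cM'] bM' colM' atM'] _] := freeN _ atN.
  (* If [b t] were unmatched, adding [t] to [M'] would contradict the maximality of [M]. *)
  apply: contraT => bt; suff: #|t |: M'| <= #|M|.
    rewrite cardsU1 cM'; suff -> : t \notin M' by rewrite ltnn.
    by apply: contra atM'; apply: imset_f.
  apply: maxM; first by rewrite subUset sub1set tD.
  apply: rainbow_matchingU1; rewrite ?bM' ?tc //.
  by apply/negP=> /colM'; rewrite inE /= (negPf c_cs) (negPf c_M).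
(* These edges of [M] can be exchanged for edges of [T], which frees their [a]-ends. *)
pose Q := [set e in M | b e \in b @: T].
have sQM : Q \subset M by apply/subsetP=> e; rewrite inE => /andP[].
have cardQ : #|Q| = #|T|.
  have <- : #|b @: T| = #|T|.
    apply: card_in_imset => e f; rewrite inE => /andP[eD _].
    by rewrite inE => /andP[fD _]; apply: class_injective eD fD.
  have -> : b @: T = b @: Q; last first.
    by rewrite card_in_imset //; apply: (sub_in2 (subsetP sQM)).
  apply/eqP; rewrite eqEsubset; apply/andP; split; apply/subsetP=> x.
    move=> xT; have /imsetP[e eM xe] := subsetP bT_M _ xT.
    by rewrite xe imset_f // inE eM -xe.
  by move=> /imsetP[e]; rewrite inE => /andP[_ ?] ->.
have cardT : #|C| <= #|T| + #|N|.
  apply: leq_trans (class_large c) _.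
  rewrite -(cardsID [set e | a e \in N] Dc) addnC leq_add //.
    by apply/subset_leq_card/subsetP=> e; rewrite !inE => /andP[-> ->].
  apply: leq_trans (card_preimset_in N (class_injective (c := c) (D := D) a_proper)).
  by apply/subset_leq_card/subsetP=> e; rewrite !inE.
exists (N :\: a @: Q); split.
- exact: subset_trans (subsetDl _ _) sNM.
- have cQ : #|a @: Q| = #|Q|.
    by apply: card_in_imset; apply: (sub_in2 (subsetP sQM)).
  (* At most [#|M| - #|T|] vertices of [a @: M] remain, and [#|T|] is at least [#|C| - #|N|]; hence
     the bound on the unfreed set drops by [#|C| - #|M|]. *)
  have : #|N :\: a @: Q| <= #|a @: M :\: a @: Q| by apply/subset_leq_card/setSD.
  rewrite [X in _ <= X]cardsD (setIidPr (imsetS a sQM)) cQ card_in_imset //.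
  have := subset_leq_card sQM; have := cardT; rewrite cardQ.
  have : #|M| <= #|C| by rewrite -(card_rainbow_matching rM) max_card.
  move: cardN; rewrite mulnS; set x := (_ * size cs); set p := #|N :\: _|.
  by move: x p #|N| #|T| #|M| #|C|; clear; lia.
move=> v; rewrite inE negb_and negbK.
have [vN|vN _] := boolP (v \in N); last first.
  have [M' [fr bM' colM' vM'] M'N] := freeN _ vN.
  exists M'.
    by split=> // x /colM'; rewrite !inE => /orP[->|->] //; rewrite !orbT.
  by move=> e eM /M'N; rewrite inE negb_and => ->; rewrite ?orbT.
rewrite orbF => /imsetP[e]; rewrite inE => /andP[eM /imsetP[t tT bet]] ve.
move: tT; rewrite !inE => /andP[/andP[tD /eqP tc] atN].
have [M' frM' M'N] := freeN _ atN.
(* This is what the last clause of the induction is for: since [v] lies in [N], its edge [e] of [M]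
   has survived in [M'] and can be exchanged. *)
have eM' : e \in M' by apply: contraLR vN => /M'N; rewrite ve; exact.
exists (t |: (M' :\ e)).
  rewrite ve; apply: frees_step frM' _ _ _ _ _ => //.
  by apply: contraNneq atN => <-; rewrite -ve.
move=> f fM; rewrite !inE negb_or negb_and negbK => /andP[_ /orP[/eqP->|fM']].
  by rewrite imset_f // inE eM bet imset_f // !inE tD tc eqxx.
by rewrite (negPf (M'N _ fM fM')) andbF.
Qed.

(** Run the freeing process through all [#|C| - #|M|] missing colours; the unfreed set has
    nonnegative size. *)
Lemma maximal_rainbow_matching : (#|C| - #|M|) ^ 2 <= #|C|.
Proof.
have [||N [_ cardN _]] := freed_vertices (cs := enum (~: col @: M)).
- exact: enum_uniq.
- by move=> c; rewrite mem_enum inE.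
have cM := card_rainbow_matching rM.
have le_M : #|M| <= #|C| by rewrite -cM max_card.
have cC : #|~: (col @: M)| = #|C| - #|M| by rewrite cardsCs setCK cM.
by rewrite -mulnn; move: cardN; rewrite -cardE cC; lia.
Qed.

End Woolbright.

Lemma large_rainbow_matching (D : {set E}) :
  (forall c, #|C| <= #|[set e in D | col e == c]|) ->
  exists M : {set E}, [/\ M \subset D, rainbow_matching M & (#|C| - #|M|) ^ 2 <= #|C|].
Proof.
move=> largeD; pose P (M : {set E}) := (M \subset D) && rainbow_matching M.
have P0 : P set0 by rewrite /P sub0set rainbow_matching0.
have [M /andP[sMD rM] maxM] := arg_maxnP (fun M : {set E} => #|M|) P0.
exists M; split=> //; apply: (@maximal_rainbow_matching D) => // N sND rN.
by apply: maxM; rewrite /P sND.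
Qed.

(** In a largest rainbow matching with colours in [K], a missing colour leaves fewer than [#|K|]
    edges, whose ends block fewer than [2 * #|K|] edges of that colour. *)
Lemma greedy_rainbow_matching (D : {set E}) (K : {set C}) :
  {in K, forall c, 2 * #|K| <= #|[set e in D | col e == c]|} ->
  exists N : {set E}, [/\ N \subset D, rainbow_matching N & col @: N = K].
Proof.
move=> largeD.
pose P (M : {set E}) := [&& M \subset D, rainbow_matching M & col @: M \subset K].
have P0 : P set0 by rewrite /P sub0set rainbow_matching0 imset0 sub0set.
have [M /and3P[sMD rM sMK] maxM] := arg_maxnP (fun M : {set E} => #|M|) P0.
exists M; split=> //; apply/eqP; rewrite eqEsubset sMK /=.
apply/subsetP=> c cK; apply: contraT => cM.
have ltM : #|M| < #|K|.
  rewrite -(card_rainbow_matching rM); apply: proper_card.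
  by apply/properP; split=> //; exists c.
pose Dc := [set e in D | col e == c].
have : ~~ (Dc \subset [set e in Dc | a e \in a @: M] :|: [set e in Dc | b e \in b @: M]).
  apply: contraL ltM => /subset_leq_card; rewrite -leqNgt => le_Dc.
  have cA : #|[set e in Dc | a e \in a @: M]| <= #|M|.
    exact: leq_trans (card_preimset_in _ (class_injective a_proper)) (leq_imset_card a M).
  have cB : #|[set e in Dc | b e \in b @: M]| <= #|M|.
    exact: leq_trans (card_preimset_in _ (class_injective b_proper)) (leq_imset_card b M).
  have := largeD c cK; rewrite -/Dc; move: le_Dc.
  have := leq_card_setU [set e in Dc | a e \in a @: M] [set e in Dc | b e \in b @: M].
  move=> [/= + _]; lia.
case/subsetPn=> e eDc; rewrite !inE.
move: eDc; rewrite inE => /andP[eD /eqP ec]; rewrite eD ec eqxx /= negb_or.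
move=> /andP[ae be].
have eM : e \notin M by apply: contra ae; apply: imset_f.
have /maxM : P (e |: M).
  rewrite /P subUset sub1set eD sMD imsetU1 subUset sub1set ec cK sMK !andbT /=.
  by apply: rainbow_matchingU1; rewrite ?ec.
by rewrite /= cardsU1 eM ltnn.
Qed.

End RainbowMatching.

(** * Splitting off the reserve and combining the two matchings *)

Section FullRainbowMatching.
Local Open Scope nat_scope.

(** With m missing colours and r reserve edges, r < 2m would give n^2 at most 4 L^4 m^2, hence at
    most 4 L^4 n. *)
Lemma reserve_large (n m L r : nat) :
  m ^ 2 <= n -> n <= L ^ 2 * r -> 4 * L ^ 4 < n -> 2 * m <= r.
Proof.
move=> m2 le_n lt_n; rewrite leqNgt; apply/negP=> lt_r.
suff : n * n <= 4 * L ^ 4 * n by rewrite leq_mul2r; lia.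
apply: (@leq_trans ((L ^ 2 * (2 * m)) ^ 2)).
  by rewrite -mulnn; apply: leq_mul; apply: leq_trans le_n _; rewrite leq_mul2l ltnW ?orbT.
have -> : (L ^ 2 * (2 * m)) ^ 2 = 4 * L ^ 4 * m ^ 2 by nia.
by rewrite leq_mul2l m2 orbT.
Qed.

Lemma full_rainbow_matching (k : nat) :
  exists N0, forall (E V W C : finType) (a : E -> V) (b : E -> W) (col : E -> C),
    N0 <= #|C| ->
    (forall e f, col e = col f -> a e = a f -> e = f) ->
    (forall e f, col e = col f -> b e = b f -> e = f) ->
    (forall c, k.+1 * #|C| <= k * #|[set e | col e == c]|) ->
    exists M : {set E}, rainbow_matching a b col M /\ col @: M = setT.
Proof.
(* Each sample then takes at most a fraction 1/(2(k+1)) of a class. The two together leave a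
   fraction k/(k+1), which is at least [#|C|] edges. *)
pose q := 2 * k.+1; pose L := 4 * 4 ^ q.
have L_gt0 : 0 < L by rewrite muln_gt0 expn_gt0.
(* The second sampling involves [2 * #|C|] sets of size only about [#|C| / L], hence the modulus
   [L * L] and the factor 4 in [linear_lt_exp]. *)
have [N expN] := linear_lt_exp (leq_mul L_gt0 L_gt0).
exists (maxn N (4 * L ^ 4).+1) => E V W C a b col.
rewrite geq_max => /andP[/expN ltC gtC] a_proper b_proper large.
pose class c := [set e | col e == c].
have class_inj (T : Type) (p : E -> T) :
    (forall e f, col e = col f -> p e = p f -> e = f) ->
    forall c, {in class c &, injective p}.
  by move=> p_proper c e f; rewrite !inE => /eqP<- /eqP eq_c; apply: p_proper.
have C_class c : #|C| <= #|class c|.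
  have := large c; rewrite -/(class c); move: #|C| #|class c| => n s; nia.
have [|Y Yp] := sample_preimage (q := q) (class_inj _ _ b_proper) C_class.
  apply: (@leq_trans (2 ^ (#|C| %/ (L * L)))).
    by apply: leq_ltn_trans ltC; rewrite leq_mul2r orbT.
  by rewrite leq_pexp2l // leq_div2l // leq_pmulr.
(* [X] must take few edges of each whole class, to keep [main] large, but enough of the part ending
   in [Y], to keep [reserve] large. *)
pose D (i : C + C) := match i with
  | inl c => class c
  | inr c => [set e in class c | b e \in Y]
  end.
have C_D i : #|C| %/ L <= #|D i|.
  case: i => c /=; first exact: leq_trans (leq_div _ _) (C_class c).
  rewrite -(@leq_pmul2r L) // (leq_trans (leq_trunc_div _ _)) //.
  by rewrite (leq_trans (C_class c)) // mulnC; have [] := Yp c.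
have inj_D i : {in D i &, injective a}.
  case: i => c e f; first exact: (class_inj _ _ a_proper c).
  rewrite [in X in X -> _]inE => /andP[eD _]; rewrite inE => /andP[fD _].
  exact: (class_inj _ _ a_proper c) eD fD.
have [|X Xp] := sample_preimage (q := q) inj_D C_D.
  by rewrite -divnMA card_sum addnn -mul2n mulnA.
pose main := [set e | (a e \notin X) && (b e \notin Y)].
pose reserve := [set e | (a e \in X) && (b e \in Y)].
have main_large c : #|C| <= #|[set e in main | col e == c]|.
  have [+ _] := Yp c; have [/= + _] := Xp (inl c); have := large c; rewrite -/(class c).
  have : #|class c| <= #|[set e in main | col e == c]| +
      (#|[set e in class c | a e \in X]| + #|[set e in class c | b e \in Y]|).
    apply: leq_trans (leq_add (leqnn _) (leq_card_setU _ _)).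
    apply: leq_trans (leq_card_setU _ _); apply/subset_leq_card/subsetP=> e.
    by rewrite !inE => ->; case: (a e \in X); case: (b e \in Y).
  rewrite /q; set n := #|C|; set s := #|class c|; set x := #|_|; set y := #|_|; set z := #|_|.
  by clearbody n s x y z; clear; nia.
have reserve_class c : #|C| <= L ^ 2 * #|[set e in reserve | col e == c]|.
  have [_ leY] := Yp c; have [_ /= leX] := Xp (inr c).
  rewrite (expnD L 1 1) expn1 -(mulnA L L); apply: leq_trans (C_class c) _.
  apply: leq_trans leY _; apply: (leq_mul (leqnn L)); apply: leq_trans leX _.
  apply: (leq_mul (leqnn L)); apply/subset_leq_card/subsetP=> e.
  by rewrite !inE => /andP[/andP[-> ->] ->].
have [M [sM rM cardM]] := large_rainbow_matching a_proper b_proper main_large.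
have [|N' [sN rN colN]] :=
    greedy_rainbow_matching a_proper b_proper (D := reserve) (K := ~: (col @: M)).
  move=> c _; apply: reserve_large _ (reserve_class c) gtC.
  by rewrite cardsCs setCK (card_rainbow_matching rM).
exists (M :|: N'); split; last by rewrite imsetU colN setUCr.
apply: rainbow_matchingU => //; last by rewrite colN disjoints_subset setCK.
- apply: (disjoint_imset (Y := X)) => e.
    by move=> /(subsetP sM); rewrite inE => /andP[].
  by move=> /(subsetP sN); rewrite inE => /andP[].
- apply: (disjoint_imset (Y := Y)) => e.
    by move=> /(subsetP sM); rewrite inE => /andP[].
  by move=> /(subsetP sN); rewrite inE => /andP[].
Qed.

End FullRainbowMatching.

(** * From bipartite multigraphs to end maps *)

Theorem theorem1p3 (R : realType) (eps : R) (heps : 0 < eps) :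
  exists N0 : nat,
    forall (n : nat) (G : multigraph) (col : edge G -> 'I_n),
      (N0 <= n)%N ->
      bipartite G ->
      proper_colouring col ->
      (forall i : 'I_n, (1 + eps) * n%:R <= #|colour_class col i|%:R) ->
      exists M : {set edge G},
        [/\ matching M, rainbow col M & uses_every_colour col M].
Proof.
(* As [k * eps] is at least 1, multiplying the class bound by [k] gives the integral condition with
   [k.+1]. *)
pose k := Num.bound eps^-1.
have k_eps : 1 <= k%:R * eps.
  have /archi_boundP/ltW : 0 <= eps^-1 by rewrite invr_ge0 ltW.
  by rewrite -ler_pdivrMr // div1r.
have [N0 fullM] := full_rainbow_matching k.
exists N0 => n G col le_n [A bip] proper large.
have [a /fin_all_exists[b ab]] := fin_all_exists bip.
have meet_ne e f v : v \in ends e -> v \in ends f -> col e = col f -> e = f.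
  move=> ve vf eq_c; apply/eqP; apply: contraT => /proper; rewrite eq_c eqxx; apply.
  by apply/existsP; exists v; rewrite ve vf.
have [||||M [rM colM]] := fullM _ _ _ 'I_n a b col.
- by rewrite card_ord.
- move=> e f eq_c eq_a; apply: (meet_ne e f (a e)) => //.
    by have [_ _ ->] := ab e; rewrite !inE eqxx.
  by have [_ _ ->] := ab f; rewrite eq_a !inE eqxx.
- move=> e f eq_c eq_b; apply: (meet_ne e f (b e)) => //.
    by have [_ _ ->] := ab e; rewrite !inE eqxx orbT.
  by have [_ _ ->] := ab f; rewrite eq_b !inE eqxx orbT.
- move=> c; rewrite card_ord -(ler_nat R) !natrM.
  have := ler_wpM2l (ler0n R k) (large c); apply: le_trans.
  by rewrite mulrA ler_wpM2r // mulrDr mulr1 -natr1 lerD2l.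
have /rainbow_matchingP[aM bM cM] := rM.
exists M; split.
- move=> e f eM fM; apply: contra => /existsP[v].
  have [aeA beA ->] := ab e; have [afA bfA ->] := ab f; rewrite !inE.
  (* The mixed cases identify an [a]-end with a [b]-end, but only the former lie in [A]. *)
  case/andP=> /orP[/eqP->|/eqP->] /orP[] /eqP eq_v; apply/eqP.
  + exact: aM.
  + by rewrite -eq_v aeA in bfA.
  + by rewrite -eq_v (negPf beA) in afA.
  + exact: bM.
- by move=> e f eM fM; apply: contra => /eqP /cM ->.
- move=> i; have /imsetP[e eM ->] : i \in col @: M by rewrite colM inE.
  by exists e.
Qed.
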